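(* Let $X$ be a uniformly smooth (real) Banach space with modulus of smoothness $\rho(u)\le\gamma u^q$ for some $\gamma>0$ and $1<q\le2$, let $\mathcal D$ be a dictionary in $X$, and let $f\in X$ be a target element. Take a number $\epsilon\ge0$ and an element $f^\epsilon\in X$ such that $$\|f-f^\epsilon\|\le\epsilon,\qquad f^\epsilon/A(\epsilon)\in\mathcal A_1(\mathcal D)$$ with some number $A(\epsilon)>0$. Then for any algorithm from the class $\mathcal{WBGA}$ with weakness sequence $\{t_k\}_{k=1}^\infty$, $t_k\in[0,1]$, the remainders satisfy, for every $m\ge1$, $$\|f_m\|\le\max\Big\{2\epsilon,\;C(q,\gamma)\,(A(\epsilon)+\epsilon)\Big(1+\sum_{k=1}^m t_k^p\Big)^{-1/p}\Big\},$$ where $C(q,\gamma)=4(2\gamma)^{1/q}$ and $p=q/(q-1)$.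
   Context: A dictionary in a real Banach space $X$ is a set $\mathcal D\subset X$ such that $\|g\|\le 1$ for all $g\in\mathcal D$, the closed linear span of $\mathcal D$ is $X$, and $g\in\mathcal D$ implies $-g\in\mathcal D$. $\mathcal A_1(\mathcal D)$ is the closure in $X$ of the convex hull of $\mathcal D$. For a nonzero $h\in X$, $F_h$ denotes a norming functional of $h$: $F_h\in X'$, $\|F_h\|=1$, $F_h(h)=\|h\|$ (unique when $X$ is uniformly smooth). For $F\in X'$, $\|F\|_{\mathcal D}:=\sup_{g\in\mathcal D}F(g)$. The modulus of smoothness is $\rho(u)=\sup_{\|x\|=\|y\|=1}\frac{\|x+uy\|+\|x-uy\|}{2}-1$; $X$ is uniformly smooth if $\lim_{u\to0}\rho(u)/u=0$. The bound $\rho(u)\le\gamma u^q$ is for all $u\ge0$. An algorithm from the class $\mathcal{WBGA}$ (Weak Biorthogonal Greedy Algorithms) with weakness sequence $\{t_m\}_{m\ge1}$, applied to a target $f\in X$, produces elements $\varphi_m\in\mathcal D$ ($m\ge1$), approximants $G_m\in\operatorname{span}\{\varphi_1,\dots,\varphi_m\}$ with $G_0=0$, and remainders $f_m=f-G_m$ ($f_0=f$), such that for every $m\ge1$: (1) $F_{f_{m-1}}(\varphi_m)\ge t_m\|F_{f_{m-1}}\|_{\mathcal D}$; (2) $\|f_m\|\le\inf_{\lambda\ge0}\|f_{m-1}-\lambda\varphi_m\|$; (3) $F_{f_m}(G_m)=0$. Conditions involving $F_{f_k}$ are required only when $f_k\ne0$. *)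

(* Defs.v *)
From HB Require Import structures.
From mathcomp Require Import all_boot all_order all_algebra.
From mathcomp Require Import all_classical all_reals all_analysis.

Set Implicit Arguments.
Unset Strict Implicit.
Unset Printing Implicit Defensive.

Import Order.TTheory GRing.Theory Num.Theory.
Import numFieldNormedType.Exports.

Local Open Scope classical_set_scope.
Local Open Scope ring_scope.

Definition linear_span (R : realType) (X : lmodType R) (A : set X) : set X :=
  smallest (fun S : set X => submod_closed [in S]) A.

Definition convex_hull (R : realType) (X : lmodType R) (A : set X) : set X :=
  smallest (@convex_set R X) A.

Record dictionary (R : realType) (X : normedModType R) (D : set X) : Prop := {
  dictionary_norm_le1 : forall g, D g -> `|g| <= 1 ;
  dictionary_dense : closure (linear_span D) = setT ;
  dictionary_symmetric : forall g, D g -> D (- g) }.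

Definition A1 (R : realType) (X : normedModType R) (D : set X) : set X :=
  closure (convex_hull D).

(* For continuous F the supremum is that of a nonempty bounded set. *)
Definition dual_norm (R : realType) (X : normedModType R)
    (F : {linear X -> R^o}) : R :=
  sup [set `|F x| | x in [set x : X | `|x| <= 1]].

Definition norming_functional (R : realType) (X : normedModType R) (h : X)
    (F : {linear X -> R^o}) : Prop :=
  [/\ continuous F, dual_norm F = 1 & F h = `|h|].

Definition dict_norm (R : realType) (X : normedModType R) (D : set X)
    (F : {linear X -> R^o}) : R :=
  sup [set F g | g in D].

(* The set is bounded above by `|u|; it is empty only if X = 0, in which case
   the modulus is 0. *)
Definition modulus_smoothness (R : realType) (X : normedModType R) (u : R) : R :=
  sup [set z | exists x y : X, [/\ `|x| = 1, `|y| = 1 &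
    z = (`|x + u *: y| + `|x - u *: y|) / 2 - 1]].

Definition uniformly_smooth (R : realType) (X : normedModType R) : Prop :=
  modulus_smoothness X u / u @[u --> (0 : R)^'+] --> (0 : R).

(* [wbga D t F f phi G]: the elements phi m (m >= 1) and the approximants G m
   are a possible output, on the target f, of a Weak Biorthogonal Greedy
   Algorithm with weakness sequence t (m >= 1); phi 0 and t 0 play no role.
   F h stands for the norming functional of h and f - G m is the m-th remainder.
   No stopping rule is needed: once a remainder vanishes, [wbga_reduction]
   forces all the later ones to vanish. *)
Record wbga (R : realType) (X : normedModType R) (D : set X) (t : nat -> R)
    (F : X -> {linear X -> R^o}) (f : X) (phi G : nat -> X) : Prop := {
  wbga_dict : forall m, D (phi m.+1) ;
  wbga_init : G 0%N = 0 ;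
  wbga_span : forall m,
    linear_span [set phi k | k in [set k | (1 <= k <= m)%N]] (G m) ;
  wbga_greedy : forall m, f - G m != 0 ->
    t m.+1 * dict_norm D (F (f - G m)) <= F (f - G m) (phi m.+1) ;
  wbga_reduction : forall m,
    `|f - G m.+1| <=
      inf [set `|f - G m - l *: phi m.+1| | l in [set l : R | 0 <= l]] ;
  wbga_biorthogonal : forall m, f - G m.+1 != 0 ->
    F (f - G m.+1) (G m.+1) = 0 }.

(* Main.v *)
Require Import Defs.
From HB Require Import structures.
From mathcomp Require Import all_boot all_order all_algebra.
From mathcomp Require Import all_classical all_reals all_analysis.
From mathcomp Require Import ring lra.

(** Write [a_k] for the norm of the [k]-th remainder. As long as [a_k > 2 eps], the
norming functional [F] of the remainder satisfies [F f = a_k] by biorthogonality,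
so [F feps >= a_k / 2] and the dictionary norm of [F] is at least
[a_k / (2 Aeps)]. Smoothness then bounds the reduction along [phi (k+1)], and an
optimal step length gives [b_(k+1) <= b_k (1 - t_(k+1)^p b_k^p)] for
[b_k = a_k / (C (Aeps + eps))]. The quantity [(1 + sum_(j <= k) t_j^p) b_k^p]
therefore stays at most [1]. It starts below [1] because [C >= 1], which
holds since testing the modulus of smoothness at [u = 2] forces [gamma 2^q >= 1]. *)

Set Implicit Arguments.
Unset Strict Implicit.
Unset Printing Implicit Defensive.

Import Order.TTheory GRing.Theory Num.Theory.
Import numFieldNormedType.Exports.

Local Open Scope classical_set_scope.
Local Open Scope ring_scope.

(** * Smoothness estimates for vectors of any length *)

Lemma modulus_smoothness_ge (R : realType) (X : normedModType R) (u : R)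
    (x y : X) : 0 <= u -> `|x| = 1 -> `|y| = 1 ->
  (`|x + u *: y| + `|x - u *: y|) / 2 - 1 <= modulus_smoothness X u.
Proof.
move=> u0 x1 y1; apply: ub_le_sup; last by exists x, y.
exists u => _ [a [b [a1 b1 ->]]].
have uE : `|u *: b| = u by rewrite normrZ b1 mulr1 ger0_norm.
have := ler_normD a (u *: b); have := ler_normB a (u *: b).
by rewrite uE a1; lra.
Qed.

(** Normalizing both vectors turns the step [l] into [u = l |y| / |x|]. Since [y] has norm at most
    1, [u] is at most [l / |x|], and the power [q] is monotone. The case [y = 0], which cannot be
    normalized, is treated apart. *)
Lemma norm_sum_le (R : realType) (X : normedModType R) (gamma q l : R)
    (x y : X) : 0 <= gamma -> 0 <= q ->
  (forall u : R, 0 <= u -> modulus_smoothness X u <= gamma * u `^ q) ->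
  x != 0 -> `|y| <= 1 -> 0 <= l ->
  `|x + l *: y| + `|x - l *: y| <= 2 * `|x| * (1 + gamma * (l / `|x|) `^ q).
Proof.
move=> g0 q0 rho_le x0 y1 l0.
have a0 : 0 < `|x| by rewrite normr_gt0.
have an0 : `|x| != 0 by rewrite gt_eqF.
have [-> | y0] := eqVneq y 0.
  rewrite scaler0 addr0 subr0.
  have := mulr_ge0 (ltW a0) (mulr_ge0 g0 (powR_ge0 (l / `|x|) q)); lra.
have b0 : 0 < `|y| by rewrite normr_gt0.
have bn0 : `|y| != 0 by rewrite gt_eqF.
set u := l * `|y| / `|x|.
have u0 : 0 <= u by rewrite !mulr_ge0 ?invr_ge0.
have nx1 (z : X) : z != 0 -> `| `|z|^-1 *: z| = 1.
  by move=> z0; rewrite normrZ ger0_norm ?invr_ge0// mulVf// normr_eq0.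
have uy : u *: (`|y|^-1 *: y) = `|x|^-1 *: (l *: y).
  by rewrite !scalerA /u; congr (_ *: _); field; rewrite an0 bn0.
have /le_trans/(_ (rho_le u u0)) :=
  modulus_smoothness_ge u0 (nx1 _ x0) (nx1 _ y0).
rewrite uy -scalerDr -scalerBr !normrZ ger0_norm ?invr_ge0// => H.
have uq : u `^ q <= (l / `|x|) `^ q.
  apply: ge0_ler_powR; rewrite ?nnegrE ?divr_ge0 ?mulr_ge0//.
  by rewrite /u ler_pM2r ?invr_gt0// ler_piMr.
have {uq}H2 := le_trans H (ler_wpM2l g0 uq).
set S := `|x + _| + _; set w := gamma * _ in H2 *.
have -> : S = 2 * `|x| * ((`|x|^-1 * `|x + l *: y| + `|x|^-1 * `|x - l *: y|) / 2).
  by rewrite /S; field.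
by rewrite ler_pM2l ?mulr_gt0//; lra.
Qed.

(** * Norming functionals and the closed convex hull *)

Lemma norming_functional_le (R : realType) (X : normedModType R) (h : X)
    (F : {linear X -> R^o}) :
  norming_functional h F -> forall x, F x <= `|x|.
Proof.
move=> [_ dF _] x; have [-> | x0] := eqVneq x 0; first by rewrite linear0 normr0.
have n0 : 0 < `|x| by rewrite normr_gt0.
(* [sup] takes the default value 0 when no supremum exists, so a dual norm equal to 1 forces the set
   to be bounded. *)
have supF : has_sup [set `|F x| | x in [set x : X | `|x| <= 1]].
  apply: contrapT => /sup_out; rewrite -/(dual_norm F) dF.
  by move/eqP; rewrite oner_eq0.
have : `|F (`|x|^-1 *: x)| <= dual_norm F.
  apply: (ub_le_sup supF.2); exists (`|x|^-1 *: x) => //=.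
  by rewrite normrZ ger0_norm ?invr_ge0// mulVf// gt_eqF.
rewrite dF linearZ /= => /(le_trans (ler_norm _)).
by rewrite -[_ *: _]/(_ * F x) mulrC ler_pdivrMr// mul1r.
Qed.

(** An induction principle for [A1 D], applied below to the closed unit ball and to a closed
    half-space. *)
Lemma A1_ind (R : realType) (X : normedModType R) (D S : set X) :
  closed S -> @convex_set R X S -> D `<=` S -> A1 D `<=` S.
Proof.
move=> cS vS DS; rewrite [S](closure_id S).1//.
by apply: closureS; exact: smallest_sub.
Qed.

Lemma A1_norm_le1 (R : realType) (X : normedModType R) (D : set X) :
  dictionary D -> forall x, A1 D x -> `|x| <= 1.
Proof.
move=> dD; apply: A1_ind; last exact: dictionary_norm_le1.
  apply: (@closed_comp _ _ (fun x : X => `|x|) [set r : R | r <= 1]);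
    last exact: closed_le.
  by move=> x _; exact: norm_continuous.
apply/convex_setW => x y; rewrite !inE /= => x1 y1 l l0 l1.
have k0 : 0 <= l%:num by [].
have k1 : 0 <= 1 - l%:num by rewrite subr_ge0 ltW.
apply/mem_set; change (`|l%:num *: (x : X) + (1 - l%:num) *: (y : X)| <= 1).
apply: le_trans (ler_normD _ _) _; rewrite !normrZ !ger0_norm//.
nra.
Qed.

(** The half-space where [F] is at most [dict_norm D F] is convex, is closed by continuity of [F],
    and contains [D] because [F] is bounded by 1 there, so that the supremum is a true upper
    bound. *)
Lemma A1_dict_norm (R : realType) (X : normedModType R) (D : set X) (h : X)
    (F : {linear X -> R^o}) : dictionary D -> norming_functional h F ->
  forall x, A1 D x -> F x <= dict_norm D F.
Proof.
move=> dD nF; apply: A1_ind.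
- apply: (@closed_comp _ _ (F : X -> R^o) [set r : R | r <= dict_norm D F]);
    last exact: closed_le.
  by move=> x _; case: nF => + _ _; exact.
- apply/convex_setW => x y; rewrite !inE /= => x1 y1 l l0 l1.
  have k1 : 0 <= 1 - l%:num by rewrite subr_ge0 ltW.
  apply/mem_set; change (F (l%:num *: (x : X) + (1 - l%:num) *: (y : X)) <= dict_norm D F).
  rewrite linearD !linearZ /= -![_ *: _]/(_ * _); nra.
- move=> g Dg /=; apply: ub_le_sup; last by exists g.
  exists 1 => _ [k Dk <-]; apply: le_trans (norming_functional_le nF k) _.
  exact: dictionary_norm_le1 dD _ Dk.
Qed.

(** * Constants, step length and recursion *)

Lemma smoothness_constant_ge (R : realType) (X : normedModType R)
    (gamma q : R) (x : X) : 0 < q -> x != 0 ->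
  (forall u : R, 0 <= u -> modulus_smoothness X u <= gamma * u `^ q) ->
  1 <= gamma * 2 `^ q.
Proof.
move=> q0 x0 rho_le; set e := `|x|^-1 *: x.
have e1 : `|e| = 1.
  by rewrite normrZ ger0_norm ?invr_ge0// mulVf// normr_eq0.
have n2 : 0 <= 2 :> R by [].
(* Both unit vectors are [e]: the norms of [3 e] and [- e] average to 2, so the modulus at 2 is at
   least 1. *)
have /le_trans/(_ (rho_le 2 n2)) := modulus_smoothness_ge n2 e1 e1.
have -> : e + 2 *: e = 3 *: e by rewrite !scaler_nat -mulrS.
have -> : e - 2 *: e = - e by rewrite scaler_nat mulr2n opprD addrA subrr sub0r.
rewrite normrN normrZ e1 normr_nat; lra.
Qed.

Lemma powRV (R : realType) (a r : R) : 0 <= a -> a^-1 `^ r = (a `^ r)^-1.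
Proof. by move=> a0; rewrite -powR_inv1// -powRrM mulN1r powRN. Qed.

(* The step [l] is chosen so that the second term is half the first. *)
Lemma optimal_step (R : realType) (gamma q A a t : R) :
  0 < gamma -> 1 < q -> 0 < A -> 0 < a -> 0 <= t ->
  let p := q / (q - 1) in
  let C := 4 * (2 * gamma) `^ (1 / q) in
  exists2 l, 0 <= l &
    l * t / (2 * A) - 2 * gamma * (l / a) `^ q = t `^ p * (a / (C * A)) `^ p.
Proof.
move=> g0 q1 A0 a0 t0 p C.
have q0 : 0 < q by lra.
have qn0 : q != 0 by rewrite gt_eqF.
have q1n0 : q - 1 != 0 by rewrite gt_eqF// subr_gt0.
have g2 : 0 <= 2 * gamma by lra.
(* With [s = p - 1], all exponents reduce to [s] through [p = s + 1] and [s q = p]. *)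
set s := (q - 1)^-1.
have s0 : 0 < s by rewrite invr_gt0 subr_gt0.
have pE : p = s + 1 by rewrite /p /s; field.
have qsE : s * q = s + 1 by rewrite -pE /p /s mulrC.
have powR_p x : 0 <= x -> x `^ p = x `^ s * x.
  move=> x0; rewrite pE powRD ?powRr1//.
  by apply/implyP; rewrite gt_eqF//; lra.
have C0 : 0 < C by rewrite mulr_gt0// powR_gt0// mulr_gt0.
set K := 8 * gamma * A.
have K0 : 0 < K by rewrite !mulr_gt0.
have aq0 : 0 < a `^ q by exact: powR_gt0.
(* This identity explains the value of [C]: the optimal gain turns out to be [w^s t / (4 A)], with
   [K] in the denominator of [w]. *)
have CAp : (C * A) `^ p = K `^ s * (4 * A).
  rewrite powRM ?(ltW C0) ?(ltW A0)// (powR_p A) ?(ltW A0)//.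
  rewrite /C powRM ?powR_ge0// -powRrM (powR_p 4)//.
  have -> : 1 / q * p = s by rewrite /p mul1r mulrA mulVf// mul1r.
  rewrite /K (_ : 8 * gamma * A = 4 * (2 * gamma) * A); last by ring.
  have g8 : 0 <= 4 * (2 * gamma) by lra.
  rewrite (powRM _ g8 (ltW A0)) (powRM s _ g2)//; ring.
(* Equating [2 gamma (l / a)^q] with [l t / (4 A)] gives [l^(q-1) = w], hence [l = w^s]. *)
set w := t * a `^ q / K.
have w0 : 0 <= w by rewrite divr_ge0 ?(ltW K0)// mulr_ge0 ?(ltW aq0).
have wK : w `^ s * t * K `^ s = t `^ p * a `^ p.
  have -> : w `^ s * t * K `^ s = (w * K) `^ s * t.
    by rewrite powRM ?(ltW K0)// mulrAC.
  rewrite /w divfK ?gt_eqF//.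
  rewrite powRM ?(ltW aq0)// -powRrM (_ : q * s = p); last by rewrite mulrC qsE.
  by rewrite (powR_p t)//; ring.
exists (w `^ s); first exact: powR_ge0.
have -> : (w `^ s / a) `^ q = w `^ s * w / a `^ q.
  rewrite powRM ?powR_ge0 ?invr_ge0 ?(ltW a0)// -powRrM qsE -pE powR_p//.
  by rewrite powRV ?(ltW a0).
have CA0 : 0 <= C * A by rewrite mulr_ge0 ?(ltW C0) ?(ltW A0).
rewrite powRM ?invr_ge0 ?(ltW a0)// powRV//.
have Ks0 : 0 < K `^ s by exact: powR_gt0.
rewrite [RHS]mulrA -wK CAp /w /K; field.
by rewrite !gt_eqF//.
Qed.

(** With [y = x b^p] in [0, 1], [p >= 1] gives [(1 - y)^p <= 1 - y], so the left side is at most [(s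
    b^p + y) (1 - y) <= (1 + y) (1 - y) <= 1]. *)
Lemma recursion_step (R : realType) (p b b' s x : R) :
  1 <= p -> 0 <= b -> 0 <= b' -> 0 <= x -> 0 <= s ->
  b' <= b * (1 - x * b `^ p) -> s * b `^ p <= 1 ->
  (s + x) * b' `^ p <= 1.
Proof.
move=> p1 b0 b'0 x0 s0 b'le sb.
have p0 : 0 < p by lra.
have bp0 := powR_ge0 b p.
have [bE | bn0] := eqVneq b 0.
  have -> : b' = 0 by apply/eqP; rewrite eq_le b'0 andbT; move: b'le; rewrite bE mul0r.
  by rewrite powR0 ?gt_eqF// mulr0.
have bgt0 : 0 < b by rewrite lt_def bn0.
set y := x * b `^ p in b'le.
have y0 : 0 <= y by exact: mulr_ge0.
(* The sign comes from [0 <= b' <= b (1 - y)] with [b > 0]. *)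
have y1 : 0 <= 1 - y.
  by rewrite -(pmulr_rge0 _ bgt0); exact: le_trans b'le.
have y2 : 1 - y <= 1 by lra.
have H : b' `^ p <= b `^ p * (1 - y).
  apply: (@le_trans _ _ ((b * (1 - y)) `^ p)).
    by apply: ge0_ler_powR; rewrite ?nnegrE ?(ltW p0) ?mulr_ge0.
  rewrite powRM// ler_wpM2l//.
  have [-> | yn] := eqVneq (1 - y) 0; first by rewrite powR0 ?gt_eqF.
  by rewrite ge1r_powR// lt_def yn y1.
apply: le_trans (ler_wpM2l (addr_ge0 s0 x0) H) _.
have -> : (s + x) * (b `^ p * (1 - y)) = (s * b `^ p + y) * (1 - y).
  by rewrite /y; ring.
nra.
Qed.

(** * Decay of the remainders *)

Theorem theorem5p2 (R : realType) (X : completeNormedModType R)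
    (smoothX : uniformly_smooth X)
    (gamma q : R) (gamma_gt0 : 0 < gamma) (q_gt1 : 1 < q) (q_le2 : q <= 2)
    (rho_le : forall u : R, 0 <= u -> modulus_smoothness X u <= gamma * u `^ q)
    (D : set X) (dictD : dictionary D)
    (f : X) (eps : R) (eps_ge0 : 0 <= eps) (feps : X) (Aeps : R)
    (Aeps_gt0 : 0 < Aeps)
    (f_feps : `|f - feps| <= eps) (feps_A1 : A1 D (Aeps^-1 *: feps))
    (t : nat -> R) (t01 : forall k : nat, (1 <= k)%N -> 0 <= t k <= 1)
    (F : X -> {linear X -> R^o})
    (normingF : forall h : X, h != 0 -> norming_functional h (F h))
    (phi G : nat -> X) (algo : wbga D t F f phi G)
    (m : nat) (m_ge1 : (1 <= m)%N) :
  let p := q / (q - 1) in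
  let C := 4 * (2 * gamma) `^ (1 / q) in
  `|f - G m| <=
    Num.max (2 * eps)
      (C * (Aeps + eps) * (1 + \sum_(1 <= k < m.+1) t k `^ p) `^ (- 1 / p)).
Proof.
cbv zeta; set p := q / (q - 1); set C := 4 * (2 * gamma) `^ (1 / q).
rewrite le_max; apply/orP.
have [| small] := leP (`|f - G m|) (2 * eps); [by left | right].
case: algo => Dphi G0 _ greedy reduction biorth.
have q0 : 0 < q by lra.
have p1 : 1 <= p.
  by rewrite /p ler_pdivlMr ?subr_gt0// mul1r; lra.
have p0 : 0 < p by lra.
(* The step length 0 is admissible in the infimum. Hence all remainders up to [m] exceed [2 eps] and
   are nonzero, and their norming functionals are available. *)
have nonincr k : `|f - G k.+1| <= `|f - G k|.
  apply: le_trans (reduction k) _.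
  have := @ge_inf _ [set `|f - G k - l *: phi k.+1| | l in [set l : R | 0 <= l]].
  move=> /(_ _)/(_ `|f - G k|); apply.
    by exists 0 => _ [l _ <-].
  by exists 0; rewrite /= ?scale0r ?subr0.
have large k : (k <= m)%N -> 2 * eps < `|f - G k|.
  move=> km; apply: lt_le_trans small _.
  by rewrite -(subnK km); elim: (m - k)%N => //= n; exact: le_trans (nonincr _).
have remainder_gt0 k : (k <= m)%N -> 0 < `|f - G k|.
  by move=> /large; apply: le_lt_trans; rewrite mulr_ge0.
have x0 : f - G 0%N != 0 by rewrite -normr_gt0 remainder_gt0.
(* Taking the [q]-th root of [2^(-q) <= 2 gamma] even gives [C >= 2]. *)
have C1 : 1 <= C.
  have g2 : 0 < 2 * gamma by lra.
  have : 2^-1 `^ q <= 2 * gamma.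
    rewrite powRV// -[leLHS]mul1r ler_pdivrMr ?powR_gt0//.
    have := smoothness_constant_ge q0 x0 rho_le; lra.
  move/(@ge0_ler_powR _ (1 / q)); rewrite ?nnegrE ?powR_ge0 ?(ltW g2) ?divr_ge0 ?(ltW q0)//.
  move=> /(_ isT isT isT); rewrite -powRrM mulrCA mulfV ?gt_eqF// mulr1 powRr1// /C; lra.
(* The one-step estimate produces [C * Aeps]; the larger [B] also dominates the norm of [f], which
   starts the induction. *)
set B := C * (Aeps + eps).
have CA0 : 0 < C * Aeps by apply: mulr_gt0 => //; lra.
have CAB : C * Aeps <= B by rewrite ler_pM2l; lra.
have B0 : 0 < B by exact: lt_le_trans CAB.
have fepsE : feps = Aeps *: (Aeps^-1 *: feps).
  by rewrite scalerA mulfV ?scale1r// gt_eqF.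
have norm_f : `|f| <= Aeps + eps.
  have -> : f = feps + (f - feps) by rewrite addrC subrK.
  apply: le_trans (ler_normD _ _) (lerD _ f_feps).
  rewrite fepsE normrZ gtr0_norm// ler_piMr ?(ltW Aeps_gt0)//.
  exact: A1_norm_le1 feps_A1.
set b := fun k => `|f - G k| / B.
have b_ge0 k : 0 <= b k by rewrite divr_ge0// ltW.
have step k : (k < m)%N -> b k.+1 <= b k * (1 - t k.+1 `^ p * b k `^ p).
  move=> km; have a0 := remainder_gt0 k (ltnW km).
  have xn0 : f - G k != 0 by rewrite -normr_gt0.
  have nF := normingF _ xn0.
  have /andP[t0 t1] := t01 k.+1 isT.
  have FG : F (f - G k) (G k) = 0.
    by case: k xn0 {nF a0 km t0 t1} => [|k] xn0; [rewrite G0 linear0 | exact: biorth].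
  have Ff : F (f - G k) f = `|f - G k|.
    by case: nF => _ _ <-; rewrite [RHS]linearB /= FG subr0.
  have F1 := norming_functional_le nF.
  (* [F feps >= F f - eps], and [eps] is less than half the norm of the remainder. Dividing by
     [Aeps] lands in [A1 D]. *)
  have dict_ge : `|f - G k| / (2 * Aeps) <= dict_norm D (F (f - G k)).
    have := A1_dict_norm dictD nF feps_A1.
    have Ffeps : `|f - G k| - eps <= F (f - G k) feps.
      have := le_trans (F1 (f - feps)) f_feps.
      rewrite linearB /= Ff; lra.
    rewrite linearZ /= -[_ *: _]/(_ * F _ feps); apply: le_trans.
    rewrite invfM mulrA mulrC ler_pM2l ?invr_gt0//.
    have := large _ (ltnW km); lra.
  have Fphi : t k.+1 * (`|f - G k| / (2 * Aeps)) <= F (f - G k) (phi k.+1).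
    exact: le_trans (ler_wpM2l t0 dict_ge) (greedy _ xn0).
  have [l l0 lE] := optimal_step gamma_gt0 q_gt1 Aeps_gt0 a0 t0.
  (* Smoothness bounds the sum of the norms at steps [l] and [-l], while [F] bounds the norm at [+l]
     from below; the difference bounds the norm at [-l]. *)
  have upper := norm_sum_le (ltW gamma_gt0) (ltW q0) rho_le xn0
    (dictionary_norm_le1 dictD (Dphi k)) l0.
  have lower := F1 (f - G k + l *: phi k.+1).
  have red : `|f - G k.+1| <= `|f - G k - l *: phi k.+1|.
    apply: le_trans (reduction k) _; apply: ge_inf; last by exists l.
    by exists 0 => _ [? _ <-].
  have Fx : F (f - G k) (f - G k) = `|f - G k| by case: nF.
  move: lower; rewrite linearD linearZ /= Fx -[_ *: _]/(l * F _ (phi _)) => lower.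
  have lphi := ler_wpM2l l0 Fphi.
  have drop : `|f - G k.+1| <=
      `|f - G k| * (1 - t k.+1 `^ p * (`|f - G k| / (C * Aeps)) `^ p).
    rewrite -lE; set v := (l / _) `^ q in upper *; lra.
  (* After division by [B], replacing [C * Aeps] by [B] inside the power only weakens the bound. *)
  rewrite /b mulrAC ler_pM2r ?invr_gt0//; apply: le_trans drop _.
  rewrite ler_pM2l// lerD2l lerN2 ler_wpM2l ?powR_ge0//.
  apply: ge0_ler_powR; rewrite ?nnegrE ?(ltW p0) ?divr_ge0 ?(ltW B0) ?(ltW CA0)//.
  by rewrite ler_pM2l// lef_pV2.
have invariant k : (k <= m)%N ->
    (1 + \sum_(1 <= j < k.+1) t j `^ p) * b k `^ p <= 1.
  elim: k => [_|k IH km].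
    rewrite big_geq// addr0 mul1r.
    apply: (@le_trans _ _ (1 `^ p)); last by rewrite powR1.
    apply: ge0_ler_powR; rewrite ?nnegrE ?(ltW p0)//.
    rewrite /b G0 subr0 ler_pdivrMr// mul1r; apply: le_trans norm_f _.
    by rewrite ler_peMl//; lra.
  rewrite big_nat_recr//= addrA; apply: recursion_step (step _ km) (IH (ltnW km)) => //.
  - exact: powR_ge0.
  - by rewrite addr_ge0// sumr_ge0// => j _; exact: powR_ge0.
set S := 1 + _.
have S0 : 0 < S.
  by rewrite ltr_pwDl// sumr_ge0// => j _; exact: powR_ge0.
(* Divided by [B], the goal is the [p]-th root of the invariant at [m]. *)
rewrite -/B mulrC -ler_pdivrMr// -/(b m) mulNr powRN -powRV ?(ltW S0)//.
have -> : b m = (b m `^ p) `^ (1 / p).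
  by rewrite -powRrM mulrCA mulfV ?gt_eqF// mulr1 powRr1.
apply: ge0_ler_powR; rewrite ?nnegrE ?powR_ge0 ?mul1r ?invr_ge0 ?(ltW p0) ?(ltW S0)//.
by rewrite -[leRHS]mul1r ler_pdivlMr// mulrC invariant.
Qed.
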